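(* Let $E$ be a real or complex locally convex topological vector space and $f,g\in\Gamma_0(E)$. Let $x\in E$ be such that $\partial f(x)\neq\emptyset$ and $\partial g(x)\neq\emptyset$. Then, for any $x^*\in\partial f(x)$ and $z^*\in\partial g(x)$ we have $$0\leq f\nabla g(x)-L(f,g)(x)\leq\frac16\Big(\mathcal F_g(x,x^* )\nabla\mathcal F_f(x,z^* )\Big).$$ Or, equivalently (for the point-wise order), $$0\leq f\nabla g-L(f,g)\leq\frac16\Big(f\nabla g-(f\diamond g)\nabla(g\diamond f)\Big).$$
   Context: $E^*$ is the topological dual of $E$, with duality bracket $\langle x^*,x\rangle$. Conventions in $[-\infty,+\infty]$: $a+(+\infty)=+\infty$ for every $a$ (including $a=-\infty$), $(+\infty)-(+\infty)=+\infty$, $c-(-\infty)=+\infty$ for every $c$, $0\cdot(+\infty)=+\infty$; $a\le b$ means $b-a\ge 0$, with $-\infty\le a\le+\infty$ for all $a$. Functionals are ordered point-wise. $\mathrm{dom}\,f=\{x:f(x)<+\infty\}$. $\Gamma_0(E)$ is the set of all convex lower semi-continuous proper functionals $f:E\to\mathbb R\cup\{+\infty\}$. Conjugates: $f^*(x^* )=\sup_{x\in E}\{\Re e\langle x^*,x\rangle-f(x)\}$ on $E^*$; for $\varphi:E^*\to[-\infty,+\infty]$, $\varphi^*(x)=\sup_{x^*\in E^*}\{\Re e\langle x^*,x\rangle-\varphi(x^* )\}$ on $E$. For $\lambda\in(0,1)$: $f\nabla_\lambda g=(1-\lambda)f+\lambda g$, $f!_\lambda g=\big((1-\lambda)f^*+\lambda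 g^*\big)^*$, $f\sharp_\lambda g=\frac{\sin(\pi\lambda)}{\pi}\int_0^1\frac{t^{\lambda-1}}{(1-t)^\lambda}\,f!_tg\,dt$ (integral taken point-wise); by convention $f\sharp_0g=f$, $f\sharp_1g=g$. The symbol $\nabla$ denotes the arithmetic mean $a\nabla b=\frac{a+b}{2}$, for functionals (point-wise) as well as for extended real numbers. The logarithmic mean is $L(f,g)=\int_0^1 f\sharp_tg\,dt$ (point-wise). Sub-differential: for $x\in\mathrm{dom}\,f$, $\partial f(x)=\{x^*\in E^*:\ f(z)\ge f(x)+\Re e\langle x^*,z-x\rangle\ \text{for all }z\in E\}$; it is empty when $x\notin\mathrm{dom}\,f$. For $h:E\to[-\infty,+\infty]$, $y\in E$, $y^*\in E^*$: $\mathcal F_h(y,y^* )=h(y)+h^*(y^* )-\Re e\langle y^*,y\rangle\ge0$. For $f,g\in\Gamma_0(E)$ and $x\in E$: $f\diamond g(x)=\sup_{x^*\in\partial f(x)}\{\Re e\langle x^*,x\rangle-g^*(x^* )\}$, with $\sup_\emptyset=-\infty$. *)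

(* Defs.v *)
From HB Require Import structures.
From mathcomp Require Import all_boot all_order all_algebra complex.
From mathcomp Require Import all_classical all_reals all_analysis.

Set Implicit Arguments.
Unset Strict Implicit.
Unset Printing Implicit Defensive.

Import Order.TTheory GRing.Theory Num.Theory.
Import numFieldTopology.Exports numFieldNormedType.Exports.

Local Open Scope classical_set_scope.
Local Open Scope ring_scope.

(* "Real or complex": K is R itself or R[i]. *)
Inductive real_or_complex (R : realType) : numFieldType -> Type :=
| RealScalars : real_or_complex R (R : numFieldType)
| ComplexScalars : real_or_complex R (R[i] : numFieldType).

Definition scalar_Re (R : realType) (K : numFieldType)
    (s : real_or_complex R K) : K -> R :=
  match s in real_or_complex _ K' return K' -> R with
  | RealScalars => fun z : R => z
  | ComplexScalars => fun z : R[i] => complex.Re z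
  end.

Definition scalar_of_real (R : realType) (K : numFieldType)
    (s : real_or_complex R K) : R -> K :=
  match s in real_or_complex _ K' return R -> K' with
  | RealScalars => fun t : R => t
  | ComplexScalars => fun t : R => Complex t 0
  end.

(* A tvsType is locally convex by definition
   (and need not be Hausdorff). *)
Record topdual (K : numFieldType) (E : tvsType K) := TopDual {
  topdual_fun :> {linear E -> K^o} ;
  topdual_continuous : continuous (topdual_fun : E -> K^o)
}.

(* Sums and differences of extended reals are taken in the dual scope %dE,
   where +oo is absorbing: (+oo) + (-oo) = (+oo) - (+oo) = +oo and
   c - (-oo) = +oo for every c. *)

Section ExtendedMeans.
Context {R : realType}.

(* Only used for 0 < t < 1: the library has 0 * +oo = 0, whereas the convention
   of convex analysis meant here is 0 * +oo = +oo. *)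
Definition wmean (t : R) (a b : \bar R) : \bar R :=
  ((1 - t)%:E * a + t%:E * b)%dE.

Definition amean (a b : \bar R) : \bar R := ((2^-1)%:E * (a + b))%dE.

End ExtendedMeans.

Section ConvexFunctionals.
Context {R : realType} {K : numFieldType} (s : real_or_complex R K)
  {E : tvsType K}.
Implicit Types (f g h : E -> \bar R) (phi : topdual E -> \bar R).

Definition bracket (xs : topdual E) (x : E) : R := scalar_Re s (xs x).

Definition econvex f : Prop :=
  forall (x y : E) (t : R), 0 < t -> t < 1 ->
    (f (scalar_of_real s (1 - t) *: x + scalar_of_real s t *: y)%R
       <= wmean t (f x) (f y))%E.

Definition proper f : Prop :=
  (forall x, f x != -oo%E) /\ (exists x, (f x < +oo)%E).

Definition Gamma0 f : Prop :=
  [/\ econvex f, lower_semicontinuous f & proper f].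

Definition conjugate f (xs : topdual E) : \bar R :=
  ereal_sup (range (fun x : E => ((bracket xs x)%:E - f x)%dE)).

Definition predual_conjugate phi (x : E) : \bar R :=
  ereal_sup (range (fun xs : topdual E => ((bracket xs x)%:E - phi xs)%dE)).

Definition harmonic_mean (t : R) f g : E -> \bar R :=
  predual_conjugate (fun xs => wmean t (conjugate f xs) (conjugate g xs)).

Definition geometric_mean (l : R) f g (x : E) : \bar R :=
  if l == 0 then f x else if l == 1 then g x else
  ((sin (pi * l) / pi)%:E *
   \int[lebesgue_measure]_(t in `]0%R, 1%R[)
     ((t `^ (l - 1) / (1 - t) `^ l)%:E * harmonic_mean t f g x))%E.

Definition log_mean f g (x : E) : \bar R :=
  (\int[lebesgue_measure]_(t in `[0%R, 1%R]) geometric_mean t f g x)%E.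

Definition subdiff f (x : E) : set (topdual E) :=
  [set xs | (f x < +oo)%E /\
     forall z : E, (f x + (bracket xs (z - x)%R)%:E <= f z)%dE].

Definition fenchel_gap h (y : E) (ys : topdual E) : \bar R :=
  (h y + conjugate h ys - (bracket ys y)%:E)%dE.

Definition diamond f g (x : E) : \bar R :=
  ereal_sup [set ((bracket xs x)%:E - conjugate g xs)%dE | xs in subdiff f x].

End ConvexFunctionals.

(* Main.v *)
(** Fix [x] with [f x], [g x] finite and put [H t = f !_t g (x)].  The
    Fenchel-Young inequality gives [H t <= (1 - t) f x + t g x], while testing the
    supremum defining [H t] on [x^*] in the subdifferential of [f] and on [z^*]
    in that of [g] shows that the defect is at most [t A] and at most
    [(1 - t) B], where [A] and [B] are the two Fenchel gaps.  Weighting these two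
    bounds by [1 - t] and [t], the defect is at most [t (1 - t) (A + B)].  The
    weight defining [#_l] is the density of the Beta law of parameters [l] and
    [1 - l], under which [t] has mean [l] and [t (1 - t)] has mean
    [l (1 - l) / 2]; integrating over [l] turns the bound into [(A + B) / 12].

    That this density has mass 1 is Euler's reflection formula.  The logistic
    substitution turns the Beta integral into that of [e^{lu} / (1 + e^u)] over
    the line, whose moments follow by integration by parts; the formula itself is
    proved by Herglotz' trick, from the triplication formula satisfied both by
    the integral and by [pi / sin (pi l)]. *)
Require Import Defs.
From mathcomp Require Import all_boot all_order all_algebra.
From mathcomp Require Import all_classical all_reals all_analysis.
From mathcomp Require Import measurable_realfun ring lra.

Set Implicit Arguments.
Unset Strict Implicit.
Unset Printing Implicit Defensive.

Import Order.TTheory GRing.Theory Num.Theory.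
Import numFieldTopology.Exports numFieldNormedType.Exports.

Local Open Scope classical_set_scope.
Local Open Scope ring_scope.

(** * Elementary estimates *)

Section integral_monotone.
Local Open Scope ereal_scope.

(** The integral is a difference of two suprema over simple functions, lying below the positive and
    below the negative part, and these are monotone for arbitrary functions. The means are later
    integrated over their parameter without establishing measurability. *)
Lemma le_integral_nonmeasurable d (T : measurableType d) (R : realType)
    (mu : {measure set T -> \bar R}) (D : set T) (f g : T -> \bar R) :
  (forall x, D x -> f x <= g x) ->
  \int[mu]_(x in D) f x <= \int[mu]_(x in D) g x.
Proof.
move=> fg.
have fgD x : (f \_ D) x <= (g \_ D) x.
  by rewrite !patchE; case: ifPn => // /[!inE]; exact: fg.
rewrite /integral; apply: leeB; apply: ge_ereal_sup => _ [h /= hf <-];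
  apply: ereal_sup_ubound; exists h => //= x; apply: (le_trans (hf x)).
- by rewrite !funeposE; apply: le_max2.
- by rewrite !funenegE; apply: le_max2; rewrite ?leeN2.
Qed.
End integral_monotone.

(** * Sine and cosecant near 0 *)

Section sin_estimates.
Context {R : realType}.
Implicit Types x : R.

Lemma sin_lex x : 0 <= x -> sin x <= x.
Proof.
rewrite le_eqVlt => /predU1P[<-|x0]; first by rewrite sin0.
have [|c cx] := @MVT R sin cos 0 x x0 (fun y _ => is_derive_sin y).
  by apply: continuous_subspaceT; exact: continuous_sin.
by rewrite sin0 !subr0 => ->; apply: ler_piMl; [exact: ltW|exact: cos_le1].
Qed.

(** Half-angle formula [cos x = 1 - 2 sin^2 (x / 2)] combined with [sin (x / 2) <= x / 2]. *)
Lemma cos_ge_sqr x : 0 <= x -> 1 - x ^+ 2 / 2 <= cos x.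
Proof.
move=> x0; rewrite (_ : cos x = 1 - 2 * sin (x / 2) ^+ 2); last first.
  have := cos2Dsin2 (x / 2).
  by rewrite [in cos x](splitr x) cosD; lra.
(* A negative [sin (x / 2)] forces [x > 2], and then the left side is below [-1]. *)
have [x2|x2] := leP 0 (sin (x / 2)); last first.
  have sx: - 1 <= sin (x/2) by exact: sin_geN1.
  have [|x1] := leP x 2; last by nra.
  move=> x1.
  have : 0 <= sin (x/2) by apply: sin_ge0_pi; have := @pi_ge2 R; lra.
  by rewrite leNgt x2.
have : sin (x/2) <= x/2 by apply: sin_lex; lra.
by move: x2; nra.
Qed.

(** [sin z - z * cos z] vanishes at 0 and has derivative [z * sin z], non-negative on [[0, pi]]. *)
Lemma le_xcos_sin x : 0 <= x <= pi -> x * cos x <= sin x.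
Proof.
move=> /andP[]; rewrite le_eqVlt => /predU1P[<-|x0] xpi.
  by rewrite mul0r sin0.
have d y : is_derive y (1:R) (fun z => sin z - z * cos z) (y * sin y).
  apply: is_derive_eq; rewrite /GRing.scale /=; ring.
have [|c /[!in_itv]/= /andP[c0 cx]] :=
    @MVT R (fun z => sin z - z * cos z) (fun z => z * sin z) 0 x x0 (fun y _ => d y).
  apply: continuous_subspaceT => z.
  by apply: differentiable_continuous; apply/derivable1_diffP; case: (d z).
rewrite sin0 mul0r !subr0 -subr_ge0 => ->.
by rewrite !mulr_ge0 ?ltW// sin_gt0_pi// c0 (lt_le_trans cx).
Qed.

Lemma subr_sin_le x : 0 <= x <= pi -> x - sin x <= x ^+ 3 / 2.
Proof.
move=> xpi; have := le_xcos_sin xpi; case/andP: xpi => x0 _.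
by have := cos_ge_sqr x0; nra.
Qed.

(** Here [sin x = 2 sin (x/2) cos (x/2) >= x cos^2 (x/2)], and [cos x >= 0] means
    [cos^2 (x/2) >= 1/2]. *)
Lemma sin_ge_half x : 0 <= x <= pi / 2 -> x / 2 <= sin x.
Proof.
move=> /andP[x0 xpi].
have c0 : 0 <= cos x by apply: cos_ge0_pihalf; have := @pi_gt0 R; lra.
have s : (x/2) * cos (x/2) <= sin (x/2).
  by apply: le_xcos_sin; have := @pi_gt0 R; lra.
have cc : 0 <= cos (x / 2) by apply: cos_ge0_pihalf; have := @pi_gt0 R; lra.
rewrite [in cos x](splitr x) cosD -!expr2 in c0.
have := cos2Dsin2 (x / 2) => e.
rewrite [in sin x](splitr x) sinD.
have h : 1/2 <= cos (x/2) ^+ 2 by lra.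
nra.
Qed.

(** The cubic bound on [x - sin x] is divided by [x * sin x >= x^2 / 2]. This gives
    [pi / sin (pi * l) = 1 / l + O(l)], the behaviour at 0 needed for Herglotz' trick. *)
Lemma csc_bounds x : 0 < x <= pi / 2 -> 0 <= (sin x)^-1 - x^-1 <= x.
Proof.
move=> /andP[x0 xpi].
have p := @pi_gt0 R.
have s1 : x / 2 <= sin x by apply: sin_ge_half; lra.
have s2 : sin x <= x by apply: sin_lex; lra.
have s3 : x - sin x <= x ^+ 3 / 2 by apply: subr_sin_le; lra.
have s0 : 0 < sin x by lra.
have -> : (sin x)^-1 - x^-1 = (x - sin x) / (x * sin x) by field; lra.
have xs : 0 < x * sin x by exact: mulr_gt0.
apply/andP; split; first by rewrite divr_ge0 ?subr_ge0// ltW.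
rewrite ler_pdivrMr//.
apply: (le_trans s3); have : 0 <= x * x by nra.
nra.
Qed.

End sin_estimates.

(** * Triplication formula for the cosecant *)

Section csc_triple.
Context {R : realType}.

Lemma cos_pi3 : cos (pi / 3 : R) = 1 / 2.
Proof.
have p := @pi_gt0 R.
have c0 : 0 < cos (pi / 3 : R) by apply: cos_gt0_pihalf; lra.
have := cos2Dsin2 (pi / 3 : R).
have : cos (pi / 3 + pi / 3 + pi / 3 : R) = -1.
  by rewrite (_ : _ + _ = pi) ?cospi//; field.
rewrite !cosD !sinD; set c := cos _ in c0 *; set s := sin _ => e1 e2.
(* The triple-angle relation [4 c^3 - 3 c = -1], factored. *)
have : (c + 1) * (2 * c - 1) ^+ 2 = 0.
  have -> : (c + 1) * (2 * c - 1) ^+ 2 = ((c * c - s * s) * c - (s * c + c * s) * s) + 1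
    + (3 * c) * (c ^+ 2 + s ^+ 2 - 1) by ring.
  by rewrite e1 e2; ring.
move=> /eqP; rewrite mulf_eq0 sqrf_eq0 => /orP[] /eqP; lra.
Qed.

(** Partial fractions for [sin (3 x) = 4 sin x sin (x + pi/3) sin (x + 2 pi/3)]; the numerator
    collapses to [3 (cos^2 x + sin^2 x)]. *)
Lemma csc_triple (x : R) : 0 < x < pi / 3 ->
  3 / sin (3 * x) = (sin x)^-1 - (sin (x + pi / 3))^-1 + (sin (x + 2 * (pi / 3)))^-1.
Proof.
move=> /andP[x0 xpi]; have p := @pi_gt0 R.
have s3 : 0 < sin (3 * x) by apply: sin_gt0_pi; lra.
have s1 : 0 < sin x by apply: sin_gt0_pi; lra.
have s4 : 0 < sin (x + pi / 3) by apply: sin_gt0_pi; lra.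
have s5 : 0 < sin (x + 2 * (pi / 3)) by apply: sin_gt0_pi; lra.
move: s3 s1 s4 s5.
rewrite (_ : 3 * x = x + x + x); last by ring.
rewrite (_ : x + 2 * (pi / 3) = x + pi / 3 + pi / 3); last by ring.
rewrite !(sinD, cosD) cos_pi3.
have := cos2Dsin2 (pi / 3 : R); rewrite cos_pi3.
have := cos2Dsin2 x.
set s := sin x; set c := cos x; set w := sin (pi / 3) => e1 e2.
set A := _ + c * w; set B := A * _ + _ => h1 h2 h3 h4.
have EB : B = c * w - s * (1 / 2).
  have -> : B = c * w + s * (1/4 - w ^+ 2) by rewrite /B /A; field.
  rewrite (_ : w ^+ 2 = 3/4); last lra.
  by field.
have AB : 4 * (A * B) = 3 * c ^+ 2 - s ^+ 2.
  rewrite EB (_ : 4 * _ = 4 * w ^+ 2 * c ^+ 2 - s ^+ 2); last by rewrite /A; field.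
  by rewrite (_ : w ^+ 2 = 3/4); [field|lra].
have -> : (s * c + c * s) * c + (c * c - s * s) * s = s * (4 * (A * B)).
  by rewrite AB; ring.
have -> : s^-1 - A^-1 + B^-1 = (4 * (A * B) + 4 * s * (A - B)) / (s * (4 * (A * B))).
  by field; rewrite !lt0r_neq0.
congr (_ / _); rewrite AB EB /A.
by transitivity (3 * (c ^+ 2 + s ^+ 2)); [rewrite e1 mulr1|field].
Qed.
End csc_triple.

(** * Integrals over the line and the logistic substitution *)

Section whole_line.
Context {R : realType}.
Let mu := @lebesgue_measure R.
Local Open Scope ereal_scope.

Lemma ge0_integral_itvNn_cvg (f : R -> R) :
  (forall x, 0 <= f x)%R -> measurable_fun setT f ->
  \int[mu]_(x in `[(- n%:R)%R, n%:R%R]) (f x)%:E @[n --> \oo] -->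
  \int[mu]_x (f x)%:E.
Proof.
move=> f0 mf.
have -> : [set: R] = \bigcup_n `[(- n%:R)%R, n%:R%R]%classic.
  apply/esym/seteqP; split => // x _; exists (Num.bound `|x|%R) => //=.
  by rewrite in_itv/= -ler_norml ltW// archi_boundP.
apply: ge0_nondecreasing_set_cvg_integral => //.
- move=> m n mn; rewrite subsetEset => x /=; rewrite !in_itv/= => /andP[mx xm].
  by rewrite (le_trans _ mx) ?lerN2 ?ler_nat// (le_trans xm)// ler_nat.
- by move=> n; apply/measurable_EFinP; exact: measurable_funTS.
- by move=> n x _; rewrite lee_fin.
Qed.

Lemma integralT_opp (f : R -> R) : (forall x, 0 <= f x)%R -> continuous f ->
  \int[mu]_x (f (- x))%:E = \int[mu]_x (f x)%:E.
Proof.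
move=> f0 cf.
have cN : continuous (fun x => f (- x))%R.
  by move=> x; apply: continuous_comp; [exact: continuousN|exact: cf].
have := @ge0_integral_itvNn_cvg (fun x => f (- x))%R (fun x => f0 _)
  (continuous_measurable_fun cN).
have := ge0_integral_itvNn_cvg f0 (continuous_measurable_fun cf).
move=> /cvg_lim <-// /cvg_lim <-//; congr (lim (_ @ \oo)); apply/funext => n.
rewrite -[X in `[_, X]%R]opprK integration_by_substitution_oppr ?opprK//.
- by apply: eq_integral => x _ /=; rewrite opprK.
- by apply: (@le_trans _ _ 0%R); rewrite ?oppr_le0.
- exact: continuous_subspaceT.
Qed.

(** Integration by parts on the line: the boundary terms [F n - F (-n)] vanish in the limit. Keeping
    [p] and [q] apart, both non-negative, lets the identity make sense even when the two integrals
    are infinite. *)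
Lemma ge0_integralT_eq_of_derive (p q F : R -> R) :
  (forall x, 0 <= p x)%R -> (forall x, 0 <= q x)%R ->
  continuous p -> continuous q ->
  (forall x : R, is_derive x 1%R F (p x - q x)%R) ->
  F n%:R @[n --> \oo] --> 0%R -> F (- n%:R)%R @[n --> \oo] --> 0%R ->
  \int[mu]_x (p x)%:E = \int[mu]_x (q x)%:E.
Proof.
move=> p0 q0 cp cq dF Fy FNy.
have := ge0_integral_itvNn_cvg p0 (continuous_measurable_fun cp).
have hq := ge0_integral_itvNn_cvg q0 (continuous_measurable_fun cq).
have cF : continuous F.
  by move=> x; apply: differentiable_continuous; apply/derivable1_diffP; case: (dF x).
have ip n (h : R -> R) : continuous h ->
    mu.-integrable `[(- n%:R)%R, n%:R%R] (EFin \o h).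
  move=> ch; apply: continuous_compact_integrable; first exact: segment_compact.
  exact: continuous_subspaceT.
(* The fundamental theorem is applied on a non-degenerate interval, whence [0 < n]; the limit only
   sees large [n]. *)
have E n : (0 < n)%N -> \int[mu]_(x in `[(- n%:R)%R, n%:R%R]) (p x)%:E =
    \int[mu]_(x in `[(- n%:R)%R, n%:R%R]) (q x)%:E + (F n%:R - F (- n%:R))%:E.
  move=> n0.
  have : \int[mu]_(x in `[(- n%:R)%R, n%:R%R]) (p x - q x)%:E =
      (F n%:R)%:E - (F (- n%:R))%:E.
    apply: (@continuous_FTC2 _ (fun x => p x - q x)%R).
    - by apply: (@lt_trans _ _ 0%R); rewrite ?oppr_lt0 ltr0n.
    - by apply: continuous_subspaceT => x; apply: continuousB; [exact: cp|exact: cq].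
    - split => [x _||]; first by case: (dF x).
      + by apply: cvg_at_right_filter; exact: cF.
      + by apply: cvg_at_left_filter; exact: cF.
    - by move=> x _; rewrite derive1E; case: (dF x).
  under eq_integral do rewrite EFinB.
  rewrite integralB_EFin//; [|exact: ip|exact: ip] => h; rewrite [X in _ + X]EFinB -h.
  rewrite addeC subeK//; exact: integrable_fin_num (ip n q cq).
move=> /cvg_lim <-//; apply/cvg_lim => //.
rewrite -[X in _ --> X]adde0.
have : (\int[mu]_(x in `[(- n%:R)%R, n%:R%R]) (q x)%:E +
    (F n%:R - F (- n%:R))%:E) @[n --> \oo] --> \int[mu]_x (q x)%:E + 0.
  apply: cvgeD => //; first by rewrite fin_num_adde_defl.
  apply: cvg_EFin; first exact: nearW.
  by rewrite /comp/= -[X in _ --> X]subr0; apply: cvgB.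
apply: cvg_trans; apply: near_eq_cvg; near=> n.
by rewrite E//; near: n; exact: nbhs_infty_gt.
Unshelve. all: by end_near. Qed.

End whole_line.

Section logistic.
Context {R : realType}.
Let mu := @lebesgue_measure R.

Definition logistic (u : R) : R := expR u / (1 + expR u).

Lemma addr1_expR_gt0 (u : R) : 0 < 1 + expR u.
Proof. by rewrite addr_gt0// expR_gt0. Qed.

Lemma is_derive_logistic (u : R) :
  is_derive u (1:R) logistic (logistic u * (1 - logistic u)).
Proof.
have e0 := lt0r_neq0 (addr1_expR_gt0 u).
have dV : is_derive u (1:R) (fun v => (1 + expR v)^-1)
    (- ((1 + expR u) ^- 2) *: (expR u)).
  apply: is_deriveV => //.
  by apply: is_derive_eq; rewrite add0r mul1r.
have -> : logistic = expR * (fun v => (1 + expR v)^-1) by [].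
apply: is_derive_eq (is_deriveM (is_derive_expR u) dV) _.
rewrite /= /logistic /GRing.scale /=.
by rewrite !fctE; field.
Qed.

Lemma continuous_logistic : continuous logistic.
Proof.
move=> u; apply: differentiable_continuous; apply/derivable1_diffP.
by case: (is_derive_logistic u).
Qed.

Lemma logistic_itv (u : R) : 0 < logistic u < 1.
Proof.
have e0 := addr1_expR_gt0 u; have e1 := expR_gt0 u.
rewrite /logistic divr_gt0//= ltr_pdivrMr//; lra.
Qed.

Lemma onem_logistic (u : R) : 1 - logistic u = (1 + expR u)^-1.
Proof. by have := lt0r_neq0 (addr1_expR_gt0 u) => e0; rewrite /logistic; field. Qed.

Lemma lt_logistic (u v : R) : u < v -> logistic u < logistic v.
Proof.
move=> uv; rewrite -ltrN2 -(ltrD2l 1) !onem_logistic.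
by rewrite ltf_pV2 ?posrE ?addr1_expR_gt0// ltrD2l ltr_expR.
Qed.

Lemma logistic_ln (t : R) : 0 < t < 1 -> logistic (ln (t / (1 - t))) = t.
Proof.
move=> /andP[t0 t1]; rewrite /logistic lnK ?posrE ?divr_gt0 ?subr_gt0//.
have t'0 : 1 - t != 0 by rewrite subr_eq0 gt_eqF.
have -> : 1 + t / (1 - t) = (1 - t)^-1 by field.
by field.
Qed.

(** [G] may blow up at 0 and 1, so the change of variable is made on [[-n, n]]; the images exhaust
    []0, 1[], and monotone convergence applies on both sides. *)
Lemma integral_logistic (G : R -> R) :
  (forall t, 0 < t < 1 -> 0 <= G t) -> {in `]0, 1[, continuous G} ->
  (\int[mu]_(t in `]0%R, 1%R[) (G t)%:E =
   \int[mu]_u (G (logistic u) * (logistic u * (1 - logistic u)))%:E)%E.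
Proof.
move=> G0 cG.
have cs : continuous (fun u : R => logistic u * (1 - logistic u)).
  move=> u; apply: (@continuousM _ _ logistic); first exact: continuous_logistic.
  by apply: continuousB; [exact: cst_continuous|exact: continuous_logistic].
have cGs : continuous (fun u => G (logistic u) * (logistic u * (1 - logistic u))).
  move=> u; apply: (@continuousM _ _ (G \o logistic)); last exact: cs.
  apply: continuous_comp; first exact: continuous_logistic.
  by apply: cG; rewrite in_itv/= logistic_itv.
have := @ge0_integral_itvNn_cvg _
  (fun u => G (logistic u) * (logistic u * (1 - logistic u))) _ (continuous_measurable_fun cGs).
move=> /(_ _)/cvg_lim <-//; last first.
  move=> u; have /andP[s0 s1] := logistic_itv u.
  by rewrite mulr_ge0 ?G0 ?s0// mulr_ge0 ?subr_ge0// ltW.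
have -> : `]0, 1[%classic = \bigcup_n `[logistic (- n%:R), logistic n%:R]%classic.
  apply/seteqP; split => t /=.
    rewrite in_itv/= => t01.
    exists (Num.bound `|ln (t / (1 - t))|) => //=.
    have : `|ln (t / (1 - t))| <= (Num.bound `|ln (t / (1 - t))|)%:R.
      by rewrite ltW// archi_boundP.
    rewrite ler_norml in_itv/=.
    have inc u v : u <= v -> logistic u <= logistic v.
      by rewrite le_eqVlt => /predU1P[->//|/lt_logistic/ltW].
    by move=> /andP[/inc + /inc]; rewrite logistic_ln// => -> ->.
  move=> [n _]/=; rewrite !in_itv/= => /andP[nt tn].
  have /andP[+ _] := logistic_itv (- n%:R); have /andP[_ +] := logistic_itv n%:R.
  by move=> ? ?; rewrite (lt_le_trans _ nt)// (le_lt_trans tn).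
have sub n : `[logistic (- n%:R), logistic n%:R]%classic `<=` `]0, 1[%classic.
  move=> t /=; rewrite !in_itv/= => /andP[nt tn].
  have /andP[+ _] := logistic_itv (- n%:R); have /andP[_ +] := logistic_itv n%:R.
  by move=> ? ?; rewrite (lt_le_trans _ nt)// (le_lt_trans tn).
have mG : measurable_fun (`]0, 1[%classic : set R) G.
  by apply: open_continuous_measurable_fun => // x /[!inE]; exact: cG.
apply/esym/cvg_lim => //.
have : (\int[mu]_(t in `[logistic (- n%:R), logistic n%:R]) (G t)%:E)%E @[n --> \oo] -->
    (\int[mu]_(t in \bigcup_n `[logistic (- n%:R), logistic n%:R]%classic) (G t)%:E)%E.
  apply: ge0_nondecreasing_set_cvg_integral => //.
  - apply/nondecreasing_seqP => n; rewrite subsetEset => t /=.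
    rewrite !in_itv/= => /andP[nt tn].
    rewrite (le_trans _ nt) ?(le_trans tn)//; apply/ltW/lt_logistic.
      by rewrite ltr_nat.
    by rewrite ltrN2 ltr_nat.
  - move=> n; apply/measurable_EFinP; apply: measurable_funS mG => //; exact: sub.
  - by move=> n t /sub/= /[!in_itv]/= /G0; rewrite lee_fin.
apply: cvg_trans; apply: near_eq_cvg; near=> n.
have dE : derive1 logistic = (fun u => logistic u * (1 - logistic u)).
  by apply/funext => u; rewrite derive1E; case: (is_derive_logistic u).
have cdE : continuous (derive1 logistic) by rewrite dE.
rewrite integration_by_substitution_increasing//.
- by apply: eq_integral => u _; rewrite dE.
- by rewrite (@le_trans _ _ 0)// oppr_le0.
- by move=> u v _ _; exact: lt_logistic.
- by apply: cvgP; apply: cvg_at_right_filter; exact: cdE.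
- by apply: cvgP; apply: cvg_at_left_filter; exact: cdE.
- split => [u _||]; first by case: (is_derive_logistic u).
  + by apply: cvg_at_right_filter; exact: continuous_logistic.
  + by apply: cvg_at_left_filter; exact: continuous_logistic.
- by apply: continuous_in_subspaceT => t /[!inE] /sub/=; exact: cG.
Unshelve. all: by end_near. Qed.

End logistic.

(** * The Beta integral *)

Section beta_kernel.
Context {R : realType}.
Let mu := @lebesgue_measure R.

Definition beta_kernel (a : R) (n : nat) (u : R) : R :=
  expR (a * u) / (1 + expR u) ^+ n.

(** Under [t = logistic u] the kernel is [t^a (1 - t)^(n - a)] and [du = dt / (t (1 - t))]: this is
    Euler's [B(a, n - a)]. It is kept in [\bar R] so that its functional equations can be proved
    before finiteness. *)
Definition beta_line (a : R) (n : nat) : \bar R :=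
  (\int[mu]_u (beta_kernel a n u)%:E)%E.

Lemma beta_kernel_ge0 a n u : 0 <= beta_kernel a n u.
Proof. by rewrite divr_ge0 ?expR_ge0// exprn_ge0// ltW// addr1_expR_gt0. Qed.

Lemma beta_kernel_opp a n u : beta_kernel a n (- u) = beta_kernel (n%:R - a) n u.
Proof.
have e0 := lt0r_neq0 (expR_gt0 u); have e1 := lt0r_neq0 (addr1_expR_gt0 u).
rewrite /beta_kernel mulrN !expRN mulrBl expRD expRN expRM_natl.
have -> : 1 + (expR u)^-1 = (1 + expR u) / expR u by field.
rewrite expr_div_n invf_div; field.
by apply/andP; split; [exact: expf_neq0|exact: lt0r_neq0 (expR_gt0 _)].
Qed.

Lemma beta_kernel1_opp a u : beta_kernel a 1 (- u) = beta_kernel (1 - a) 1 u.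
Proof. exact: beta_kernel_opp. Qed.

Lemma is_derive_beta_kernel a n (u : R) : is_derive u (1:R) (beta_kernel a n)
  (a * beta_kernel a n u - n%:R * beta_kernel (a + 1) n.+1 u).
Proof.
have e1 := lt0r_neq0 (addr1_expR_gt0 u).
have d1 : is_derive u (1:R) (fun v => expR (a * v)) (a * expR (a * u)).
  have da : is_derive u (1:R) (fun v => a * v) a.
    by apply: is_derive_eq; rewrite /GRing.scale/= mulr1.
  by apply: is_derive_eq (is_derive1_comp (is_derive_expR (a * u)) da) _; rewrite mulrC.
have d2 : is_derive u (1:R) (fun v => 1 + expR v) (expR u).
  by apply: is_derive_eq; rewrite add0r mul1r.
have d3 : is_derive u (1:R) (fun v => (1 + expR v) ^+ n)
    (n%:R * (1 + expR u) ^+ n.-1 * expR u).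
  by have := is_deriveX n d2; rewrite exprfctE.
have d4 : is_derive u (1:R) (fun v => ((1 + expR v) ^+ n)^-1)
    (- ((1 + expR u) ^+ n) ^- 2 *: (n%:R * (1 + expR u) ^+ n.-1 * expR u)).
  by apply: is_deriveV => //; rewrite expf_neq0.
have -> : beta_kernel a n =
    (fun v => expR (a * v)) * (fun v => ((1 + expR v) ^+ n)^-1) by [].
apply: is_derive_eq (is_deriveM d1 d4) _.
rewrite !fctE /beta_kernel /GRing.scale /= mulrDl mul1r expRD.
case: n {d3 d4} => [|n]; first by rewrite expr0 invr1; ring.
rewrite /= !exprS; field.
by rewrite e1 expf_neq0.
Qed.

Lemma continuous_beta_kernel a n : continuous (beta_kernel a n).
Proof.
move=> u; apply: differentiable_continuous; apply/derivable1_diffP.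
by case: (is_derive_beta_kernel a n u).
Qed.

Lemma measurable_beta_kernel a n : measurable_fun setT (beta_kernel a n).
Proof. exact: continuous_measurable_fun (@continuous_beta_kernel a n). Qed.

(** The denominator is at least 1, so [expR (- (a * k))] dominates. *)
Lemma beta_kernel_cvgNy a n : 0 < a ->
  beta_kernel a n (- k%:R) @[k --> \oo] --> (0 : R).
Proof.
move=> a0.
have : expR (- (a * k%:R)) @[k --> \oo] --> (0 : R).
  have h : a * x @[x --> +oo] --> +oo by exact: gt0_cvgMry.
  have h2 : expR (- (a * x)) @[x --> +oo] --> (0 : R).
    exact: (cvg_comp _ _ h (@cvgr_expR R)).
  exact: (cvg_comp _ _ (@cvgr_idn R) h2).
move=> h; apply: (squeeze_cvgr _ (cvg_cst (0 : R)) h).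
apply: nearW => k; rewrite beta_kernel_ge0/= /beta_kernel mulrN ler_pdivrMr; last first.
  by rewrite exprn_gt0// addr1_expR_gt0.
rewrite ler_peMr ?expR_ge0// exprn_ege1// lerDl expR_ge0//.
Qed.

Lemma beta_kernel_cvgy a n : a < n%:R ->
  beta_kernel a n k%:R @[k --> \oo] --> (0 : R).
Proof.
move=> an; have := @beta_kernel_cvgNy (n%:R - a) n.
rewrite subr_gt0 => /(_ an); apply: cvg_trans; apply: near_eq_cvg.
by apply: nearW => k; rewrite -[in RHS](opprK k%:R) [RHS]beta_kernel_opp.
Qed.

Lemma beta_line_ge0 a n : (0 <= beta_line a n)%E.
Proof. by apply: integral_ge0 => u _; rewrite lee_fin beta_kernel_ge0. Qed.

Lemma beta_line_opp a n : beta_line (n%:R - a) n = beta_line a n.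
Proof.
rewrite /beta_line -(integralT_opp (@beta_kernel_ge0 a n) (@continuous_beta_kernel a n)).
by apply: eq_integral => u _; rewrite beta_kernel_opp.
Qed.

(** Integration by parts with primitive [beta_kernel a n], which vanishes at both ends exactly
    because [0 < a < n]. *)
Lemma beta_lineS a n : 0 < a < n%:R ->
  (n%:R%:E * beta_line (a + 1) n.+1 = a%:E * beta_line a n)%E.
Proof.
move=> /andP[a0 an]; apply/esym.
have Z c b m : 0 <= c ->
    (c%:E * beta_line b m = \int[mu]_u (c * beta_kernel b m u)%:E)%E.
  move=> c0; rewrite /beta_line -ge0_integralZl_EFin//.
    by move=> u _; rewrite lee_fin beta_kernel_ge0.
  by apply/measurable_EFinP; exact: measurable_beta_kernel.
rewrite !Z ?ler0n ?ltW//.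
apply: (@ge0_integralT_eq_of_derive _ (fun u => a * beta_kernel a n u)
  (fun u => n%:R * beta_kernel (a + 1) n.+1 u) (beta_kernel a n)).
- by move=> u; rewrite mulr_ge0 ?beta_kernel_ge0// ltW.
- by move=> u; rewrite mulr_ge0 ?beta_kernel_ge0.
- by move=> u; apply: cvgMl_tmp; exact: continuous_beta_kernel.
- by move=> u; apply: cvgMl_tmp; exact: continuous_beta_kernel.
- exact: is_derive_beta_kernel.
- exact: beta_kernel_cvgy.
- exact: beta_kernel_cvgNy.
Qed.

Lemma beta_line_scale3 a n :
  beta_line a n = (3%:E * \int[mu]_u (beta_kernel a n (3 * u))%:E)%E.
Proof.
have c3 : continuous (fun u : R => 3 * u).
  by move=> u; apply: cvgMl_tmp; exact: cvg_id.
have d3 (u : R) : is_derive u (1:R) (fun v => 3 * v) 3.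
  by apply: is_derive_eq; rewrite /GRing.scale/= mulr1.
have D3 : derive1 (fun v : R => 3 * v) = cst 3.
  by apply/funext => u; rewrite derive1E; case: (d3 u).
rewrite -ge0_integralZl_EFin//; last 2 first.
- by move=> u _; rewrite lee_fin beta_kernel_ge0.
- apply/measurable_EFinP; apply: continuous_measurable_fun => u.
  by apply: continuous_comp; [exact: c3|exact: continuous_beta_kernel].
rewrite /beta_line (@increasing_ge0_integration_by_substitutionT _ (fun u => 3 * u)).
- by apply: eq_integral => u _; rewrite D3/= mulrC.
- by move=> x y xy; rewrite ltr_pM2l.
- by rewrite D3; exact: cst_continuous.
- by rewrite D3; apply: cvgP; exact: cvg_cst.
- by rewrite D3; apply: cvgP; exact: cvg_cst.
- by move=> u; case: (d3 u).
- by apply: gt0_cvgMrNy.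
- by apply: gt0_cvgMry.
- exact: continuous_beta_kernel.
- exact: beta_kernel_ge0.
Qed.

(* [1 / (1 + y) = (1 - y + y ^ 2) / (1 + y ^ 3)] with [y = expR u] *)
Lemma beta_line_triple (b : R) :
  (3%:E * beta_line (3 * b) 1 + beta_line (b + 1 / 3) 1 =
   beta_line b 1 + beta_line (b + 2 / 3) 1)%E.
Proof.
pose I c := (\int[mu]_u (beta_kernel c 1 (3 * u))%:E)%E.
have I0 c : (0 <= I c)%E.
  by apply: integral_ge0 => u _; rewrite lee_fin beta_kernel_ge0.
have mul3D (x y z w : \bar R) : (0 <= x -> 0 <= y -> 0 <= z -> 0 <= w ->
    x + y = z + w -> 3%:E * x + 3%:E * y = 3%:E * z + 3%:E * w)%E.
  by move=> x0 y0 z0 w0 xyzw; rewrite -!ge0_muleDr// xyzw.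
(* Rescaling every term but [beta_line (3 * b) 1] by [u := 3 u] makes all four kernels multiples of
   [expR (3 * b * u)]. The identity is kept in additive form, with no subtraction of possibly
   infinite integrals. *)
suff sumE : (beta_line (3 * b) 1 + I (b + 1 / 3)%R = I b + I (b + 2 / 3)%R)%E.
  rewrite [beta_line (b + 1 / 3) 1]beta_line_scale3 [beta_line b 1]beta_line_scale3.
  rewrite [beta_line (b + 2 / 3) 1]beta_line_scale3.
  exact: (mul3D _ _ _ _ (beta_line_ge0 _ _) (I0 _) (I0 _) (I0 _) sumE).
have c3 c : continuous (fun u : R => beta_kernel c 1 (3 * u)).
  move=> u; apply: continuous_comp; last exact: continuous_beta_kernel.
  by apply: cvgMl_tmp; exact: cvg_id.
have sumI (p q : R -> R) : (forall u, 0 <= p u) -> (forall u, 0 <= q u) ->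
    continuous p -> continuous q ->
    (\int[mu]_u ((p u)%:E + (q u)%:E) = \int[mu]_u (p u)%:E + \int[mu]_u (q u)%:E)%E.
  move=> p0 q0 cp cq; rewrite ge0_integralD//.
  - by move=> u _; rewrite lee_fin.
  - by apply/measurable_EFinP; exact: continuous_measurable_fun.
  - by move=> u _; rewrite lee_fin.
  - by apply/measurable_EFinP; exact: continuous_measurable_fun.
have k3 c u := beta_kernel_ge0 c 1 (3 * u).
apply: etrans (esym (sumI _ _ (beta_kernel_ge0 _ _) (k3 _) (@continuous_beta_kernel _ _) (c3 _))) _.
apply: etrans (sumI _ _ (k3 _) (k3 _) (c3 _) (c3 _)).
apply: eq_integral => u _.
rewrite -!EFinD; congr EFin; rewrite /beta_kernel !expr1.
have e0 := expR_gt0 u.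
have -> : 3 * u = u + u + u by ring.
have E (c d : R) : 3 * c = d -> expR (c * (u + u + u)) = expR (d * u).
  by move=> <-; congr expR; ring.
rewrite (E (b + 1 / 3) (3 * b + 1)); last by field.
rewrite (E (b + 2 / 3) (3 * b + 1 + 1)); last by field.
rewrite (E b (3 * b))//.
have -> : expR ((3 * b + 1) * u) = expR (3 * b * u) * expR u.
  by rewrite -expRD; congr expR; ring.
have -> : expR ((3 * b + 1 + 1) * u) = expR (3 * b * u) * expR u * expR u.
  by rewrite -!expRD; congr expR; ring.
move: (expR (3 * b * u)) => A.
rewrite !expRD; set y := expR u in e0 *.
have y1 : 1 + y != 0 by rewrite lt0r_neq0// addr_gt0.
have y3 : 1 + y * y * y != 0 by rewrite lt0r_neq0// addr_gt0// !mulr_gt0.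
by field; rewrite y1 y3.
Qed.

(** The exponential density [a * expR (- a * x)] has mass 1. *)
Lemma integral_expRNM (a : R) : 0 < a ->
  (\int[mu]_(x in `[0%R, +oo[) (expR (- a * x))%:E = (a^-1)%:E)%E.
Proof.
move=> a0.
have : (\int[mu]_(x in `[0%R, +oo[) (a * expR (- a * x))%:E = 1)%E.
  by rewrite -(integral_exponential_pdf a0) integral_mkcond restrict_EFin.
under eq_integral do rewrite EFinM.
have cexp : continuous (fun x : R => expR (- a * x)).
  move=> x; apply: continuous_comp; last exact: continuous_expR.
  by apply: cvgMl_tmp; exact: cvg_id.
rewrite ge0_integralZl_EFin ?ltW//; last first.
  by apply/measurable_EFinP; apply: measurable_funTS; exact: continuous_measurable_fun.
move=> /(congr1 (fun z => (a^-1)%:E * z)%E).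
by rewrite muleA -EFinM mulVf ?lt0r_neq0// mul1e mule1.
Qed.

(** Folding the line onto [[0, +oo[] turns the integrand into
    [(e^{-(1-l)x} + e^{-lx}) / (1 + e^{-x})], which is compared with plain exponentials. Since
    [1/(1-l) - 1/(1+l) = O(l)], the integral is [1/l + O(l)], just like [pi / sin (pi * l)]. *)
Lemma beta_line1_bounds (l : R) : 0 < l < 1 ->
  ((l^-1)%:E <= beta_line l 1)%E /\
  (beta_line l 1 + ((1 + l)^-1)%:E <= (l^-1 + (1 - l)^-1)%:E)%E.
Proof.
move=> /andP[l0 l1].
pose h u := beta_kernel l 1 u + beta_kernel (1 - l) 1 u.
have h0 u : 0 <= h u by rewrite addr_ge0 ?beta_kernel_ge0.
have ch : continuous h.
  by move=> u; apply: cvgD; exact: continuous_beta_kernel.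
have mexp (a : R) (D : set R) : measurable_fun D (fun x : R => (expR (a * x))%:E).
  apply/measurable_EFinP; apply: measurable_funTS; apply: continuous_measurable_fun => x.
  apply: continuous_comp; last exact: continuous_expR.
  by apply: cvgMl_tmp; exact: cvg_id.
(* [h] is even and integrates to twice [beta_line l 1], by the symmetry [u := - u]. *)
have J2 : beta_line l 1 = (\int[mu]_(x in `[0%R, +oo[) (h x)%:E)%E.
  have : (\int[mu]_x (h x)%:E = 2%:E * beta_line l 1)%E.
    under eq_integral do rewrite EFinD.
    rewrite ge0_integralD//; last 4 first.
    - by move=> u _; rewrite lee_fin beta_kernel_ge0.
    - by apply/measurable_EFinP; exact: measurable_beta_kernel.
    - by move=> u _; rewrite lee_fin beta_kernel_ge0.
    - by apply/measurable_EFinP; exact: measurable_beta_kernel.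
    by rewrite -[X in (_ + X)%E]/(beta_line (1%:R - l) 1) beta_line_opp mule_natl.
  rewrite ge0_symfun_integralT//; last first.
    by move=> u; rewrite /h /comp !beta_kernel1_opp subKr addrC.
  rewrite -set_itvcy => /(congr1 (fun z => (2^-1)%:E * z)%E).
  by rewrite !muleA -EFinM mulVf// !mul1e.
have bk c x : beta_kernel c 1 x = expR (- (1 - c) * x) / (1 + expR (- x)).
  by rewrite -{1}(opprK x) beta_kernel_opp /beta_kernel expr1; congr (expR _ / _); ring.
have zk x : h x = (expR (- (1 - l) * x) + expR (- l * x)) / (1 + expR (- x)).
  by rewrite /h !bk -mulrDl; congr ((_ + expR _) / _); ring.
have e01 (x : R) : 0 <= x -> 0 < expR (- x) <= 1.
  by move=> x0; rewrite expR_gt0/= -expR0 ler_expR oppr_le0.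
split.
  rewrite J2 -integral_expRNM//; apply: ge0_le_integral => //.
  - exact: mexp.
  - by apply/measurable_EFinP; apply: measurable_funTS; exact: continuous_measurable_fun.
  move=> x /=; rewrite in_itv/= andbT => x0; rewrite lee_fin zk.
  have /andP[z0 z1] := e01 _ x0; rewrite ler_pdivlMr ?addr_gt0//.
  rewrite mulrDr mulr1 addrC lerD2r -expRD ler_expR; nra.
rewrite J2 -integral_expRNM; last by lra.
rewrite EFinD -!integral_expRNM; [|lra..].
have mh : measurable_fun (`[0%R, +oo[%classic : set R) (fun x : R => (h x)%:E).
  by apply/measurable_EFinP; apply: measurable_funTS; exact: continuous_measurable_fun.
rewrite -[leLHS]ge0_integralD//; [|by move=> x _; rewrite lee_fin|exact: mexp].
rewrite -[leRHS]ge0_integralD//; [|exact: mexp|exact: mexp].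
apply: ge0_le_integral => //.
- by move=> x _; rewrite -EFinD lee_fin addr_ge0// expR_ge0.
- by apply: emeasurable_funD => //; exact: mexp.
- by apply: emeasurable_funD; exact: mexp.
move=> x /=; rewrite in_itv/= andbT => x0; rewrite -!EFinD lee_fin zk.
have /andP[z0 z1] := e01 _ x0.
rewrite -lerBrDr ler_pdivrMr ?addr_gt0//.
have -> : expR (- (1 + l) * x) = expR (- l * x) * expR (- x).
  by rewrite -expRD; congr expR; ring.
set z := expR (- x) in z0 z1 *; set B := expR (- l * x).
have B0 : 0 < B by exact: expR_gt0.
set A := expR _.
(* After clearing [1 + z], the upper bound amounts to [B * z^2 <= A * z]. *)
have AB : B * z <= A.
  by rewrite -expRD ler_expR; nra.
nra.
Qed.

End beta_kernel.

(** * Euler's reflection formula *)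

Section reflection.
Context {R : realType}.

(* Herglotz' trick without continuity: iterating the triplication moves a
   point of (0, 1) towards 0 at the cost of a factor 1 - 3^-n on the bound. *)
Lemma eq0_of_triple (D : R -> R) (C : R) :
  (forall l, 0 < l <= 1 / 2 -> `|D l| <= C * l) ->
  (forall l, 0 < l < 1 -> D (1 - l) = D l) ->
  (forall b, 0 < b < 1 / 3 -> 3 * D (3 * b) = D b - D (b + 1 / 3) + D (b + 2 / 3)) ->
  forall l, 0 < l < 1 -> D l = 0.
Proof.
move=> small sym triple.
have C0 : 0 <= C.
  by have := small (1/2); have := normr_ge0 (D (1/2)); lra.
pose S := [set `|D l| | l in [set l | 0 < l < 1]].
(* The linear bound handles [(0, 1/2]] and the symmetry carries it to the other half. *)
have bS : has_ubound S.
  exists C => _ [l /= l01 <-].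
  have [l2|l2] := leP l (1/2).
    by have := small l; nra.
  by rewrite -sym//; have := small (1 - l); nra.
pose M := sup S.
have leM l : 0 < l < 1 -> `|D l| <= M.
  by move=> l01; apply: ub_le_sup => //; exists l.
have iter n l : 0 < l < 1 ->
    `|D l| <= M * (1 - 3 ^- n) + 3 ^- n * `|D (l / 3 ^+ n)|.
  elim: n l => [|n IH] l l01.
    by rewrite expr0 invr1 subrr mulr0 mul1r add0r mulr1.
  have p0 : 0 < 3 ^- n :> R by rewrite invr_gt0 exprn_gt0.
  have p1 : 3 ^- n <= 1 :> R by rewrite invf_le1 ?exprn_ege1 ?exprn_gt0// ler1n.
  apply: (le_trans (IH _ l01)).
  set y := l / 3 ^+ n.+1; have yE : l / 3 ^+ n = 3 * y.
    by rewrite /y exprS; field; rewrite expf_neq0.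
  have y0 : 0 < y < 1 / 3.
    rewrite divr_gt0 ?exprn_gt0//=; last by lra.
    suff : 3 * y < 1 by lra.
    by rewrite -yE; nra.
  (* One triplication step: two of the three terms are bounded by the supremum, only [D y] is
     kept. *)
  have h : 3 * `|D (3 * y)| <= `|D y| + 2 * M.
    have <- : `|3 * D (3 * y)| = 3 * `|D (3 * y)| by rewrite normrM ger0_norm.
    rewrite triple//.
    have h1 : `|D (y + 1 / 3)| <= M by apply: leM; lra.
    have h2 : `|D (y + 2 / 3)| <= M by apply: leM; lra.
    rewrite (le_trans (ler_normD _ _))// (le_trans (lerD (ler_normB _ _) (lexx _)))//.
    by lra.
  rewrite yE; have -> : 3 ^- n.+1 = 3 ^- n / 3 :> R.
    by rewrite exprS; field; rewrite expf_neq0.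
  nra.
(* For [n > 0] the point [l / 3 ^+ n] is below 1/3, where the linear bound holds. Taking the
   supremum over [l] and cancelling leaves [M * 3^-n <= C * 9^-n]. *)
have MC n : (0 < n)%N -> M <= C * 3 ^- n.
  move=> n0.
  have p0 : 0 < 3 ^- n :> R by rewrite invr_gt0 exprn_gt0.
  have p3 : 3 ^- n <= 1/3 :> R.
    rewrite mul1r lef_pV2 ?posrE ?exprn_gt0//.
    by case: n n0 {p0} => // n _; rewrite exprS ler_peMr// exprn_ege1// ler1n.
  suff : M <= M * (1 - 3 ^- n) + 3 ^- n * (C * 3 ^- n) by nra.
  apply: ge_sup; first by exists `|D (1/2)|; exists (1/2) => //=; lra.
  move=> _ [l /= l01 <-]; apply: (le_trans (iter n _ l01)).
  rewrite lerD2l ler_pM2l//.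
  have /andP[l0 l1] := l01.
  have lp0 : 0 < l * 3 ^- n by exact: mulr_gt0.
  have lp1 : l * 3 ^- n <= 3 ^- n by rewrite ger_pMl// ltW.
  apply: (le_trans (small _ _)); first by lra.
  by rewrite ler_wpM2l.
have M0 : M <= 0.
  rewrite leNgt; apply/negP => M0.
  (* With [C / M < n < 3^n], the bound [M <= C * 3^-n] fails. *)
  pose n := (Num.bound (C / M)).+1.
  have := MC n isT; rewrite leNgt => /negP; apply.
  rewrite ltr_pdivrMr ?exprn_gt0// mulrC -ltr_pdivrMr//.
  rewrite (lt_le_trans (archi_boundP _)) ?divr_ge0// ?ltW//.
  by rewrite -natrX ltr_nat (ltn_trans (ltnSn _))// ltn_expl.
move=> l l01; apply/eqP; rewrite -normr_le0.
by rewrite (le_trans (leM _ l01)).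
Qed.

Lemma beta_line1_fin_num (l : R) : 0 < l < 1 -> beta_line l 1 \is a fin_num.
Proof.
move=> l01; have [_ h] := beta_line1_bounds l01.
rewrite ge0_fin_numE ?beta_line_ge0//.
apply: (@le_lt_trans _ _ (l^-1 + (1 - l)^-1)%:E); last exact: ltry.
apply: le_trans h; rewrite leeDl// lee_fin invr_ge0; lra.
Qed.

(** Both sides are [1/l + O(l)] at 0, are invariant under [l := 1 - l] and satisfy the same
    triplication formula, so their difference is zero by [eq0_of_triple]. *)
Lemma beta_line1E (l : R) : 0 < l < 1 -> beta_line l 1 = (pi / sin (pi * l))%:E.
Proof.
have p0 := @pi_gt0 R.
have jE (c : R) : 0 < c < 1 -> beta_line c 1 = (fine (beta_line c 1))%:E.
  by move=> c01; rewrite fineK//; exact: beta_line1_fin_num.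
pose D (l : R) := fine (beta_line l 1) - pi / sin (pi * l).
suff h : forall c, 0 < c < 1 -> D c = 0.
  by move=> l01; rewrite jE//; congr EFin; have := h _ l01; rewrite /D; lra.
(* [pi * pi] comes from [csc_bounds] at [pi * c], and 4 from [2 c / (1 - c^2) <= 4 c] for
   [c <= 1/2]. *)
apply: (@eq0_of_triple _ (pi * pi + 4)).
- move=> c c0; have c01 : 0 < c < 1 by lra.
  have [] := beta_line1_bounds c01; rewrite jE// -EFinD !lee_fin => h1 h2.
  have := @csc_bounds R (pi * c); have -> : 0 < pi * c <= pi / 2 by nra.
  move=> /(_ isT).
  have -> : (sin (pi * c))^-1 - (pi * c)^-1 = (pi / sin (pi * c) - c^-1) / pi.
    have s0 : 0 < sin (pi * c) by apply: sin_gt0_pi; nra.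
    by field; rewrite !lt0r_neq0//; lra.
  rewrite ler_pdivrMr// pmulr_lge0 ?invr_gt0// => /andP[h3 h4].
  have h5 : (1 - c)^-1 - (1 + c)^-1 <= 4 * c.
    have -> : (1 - c)^-1 - (1 + c)^-1 = 2 * c / ((1 - c) * (1 + c)).
      by field; rewrite !lt0r_neq0; lra.
    by rewrite ler_pdivrMr; nra.
  by rewrite /D ler_norml; apply/andP; split; nra.
- move=> c c01; rewrite /D (beta_line_opp c 1).
  have -> // : sin (pi * (1 - c)) = sin (pi * c).
  by rewrite mulrBr mulr1 addrC sinDpi sinN opprK.
- move=> b b0; have := beta_line_triple b.
  rewrite (jE (3 * b)); last by lra.
  rewrite (jE b); last by lra.
  rewrite (jE (b + 1/3)); last by lra.
  rewrite (jE (b + 2/3)); last by lra.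
  rewrite -EFinM -!EFinD => -[] e.
  have pib : 0 < pi * b < pi / 3.
    have /andP[b1 b2] := b0; apply/andP; split; first exact: mulr_gt0.
    by rewrite ltr_pM2l// -[ltRHS]mul1r.
  have e2 := csc_triple pib.
  rewrite /D.
  have -> : pi * (3 * b) = 3 * (pi * b) by ring.
  have -> : pi * (b + 1 / 3) = pi * b + pi / 3 by field.
  have -> : pi * (b + 2 / 3) = pi * b + 2 * (pi / 3) by field.
  have -> : 3 * (fine (beta_line (3 * b) 1) - pi / sin (3 * (pi * b))) =
    3 * fine (beta_line (3 * b) 1) - pi * (3 / sin (3 * (pi * b))) by ring.
  have lin (P j1 j2 j3 j4 s1 s2 s3 : R) : 3 * j1 + j2 = j3 + j4 ->
    3 * j1 - P * (s1 - s2 + s3) = j3 - P * s1 - (j2 - P * s2) + (j4 - P * s3).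
    by clear => ?; lra.
  by rewrite e2; exact: lin.
Qed.

End reflection.

(** * Moments of the Beta weight *)

Section beta_weight.
Context {R : realType}.
Let mu := @lebesgue_measure R.

Definition beta_weight (l t : R) : R := t `^ (l - 1) / (1 - t) `^ l.

Lemma beta_weight_gt0 (l t : R) : 0 < t < 1 -> 0 < beta_weight l t.
Proof. by move=> /andP[t0 t1]; rewrite divr_gt0// powR_gt0// subr_gt0. Qed.

Lemma beta_weight_continuous (l t : R) : 0 < t < 1 ->
  {for t, continuous (beta_weight l)}.
Proof.
move=> /andP[t0 t1]; have t'0 : 0 < 1 - t by rewrite subr_gt0.
have dcont (a x : R) : 0 < x -> {for x, continuous (fun y => y `^ a)}.
  move=> x0; apply: differentiable_continuous; apply/derivable1_diffP.
  by case: (@is_derive1_powR R a x x0).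
have c1 : {for t, continuous (fun t : R => (1 - t) `^ l)}.
  apply: (@continuous_comp _ _ _ (fun t : R => 1 - t) (fun y : R => y `^ l)); last exact: dcont.
  by apply: continuousB; [exact: cst_continuous|exact: cvg_id].
apply: (@continuousM _ _ (fun t : R => t `^ (l - 1)) (fun t : R => ((1 - t) `^ l)^-1)).
  exact: dcont.
by apply: cvgV; [rewrite lt0r_neq0// powR_gt0|exact: c1].
Qed.

Lemma beta_weight_monomial_ge0 (l : R) (i j : nat) (t : R) : 0 < t < 1 ->
  0 <= beta_weight l t * (t ^+ i * (1 - t) ^+ j).
Proof.
move=> /[dup] /beta_weight_gt0 w0 /andP[t0 t1].
apply: mulr_ge0; first exact: ltW.
by apply: mulr_ge0; apply: exprn_ge0; [exact: ltW|rewrite subr_ge0 ltW].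
Qed.

Lemma beta_weight_monomial_continuous (l : R) (i j : nat) (t : R) : 0 < t < 1 ->
  {for t, continuous (fun t => beta_weight l t * (t ^+ i * (1 - t) ^+ j))}.
Proof.
move=> t01.
apply: (@continuousM _ _ (beta_weight l) (fun t : R => t ^+ i * (1 - t) ^+ j)).
  exact: beta_weight_continuous.
apply: (@continuousM _ _ (fun t : R => t ^+ i) (fun t : R => (1 - t) ^+ j)).
  exact: exprn_continuous.
apply: (@continuous_comp _ _ _ (fun t : R => 1 - t) (fun y : R => y ^+ j)).
  by apply: continuousB; [exact: cst_continuous|exact: cvg_id].
exact: exprn_continuous.
Qed.

(** With [v = ln (1 + e^u)], both [t = e^{u-v}] and [1 - t = e^{-v}] are exponentials, so only
    exponents have to be compared. *)
Lemma beta_weight_logistic (l u : R) :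
  beta_weight l (logistic u) * (logistic u * (1 - logistic u)) = beta_kernel l 1 u.
Proof.
have e1 := addr1_expR_gt0 u.
pose v := ln (1 + expR u).
have vE : 1 + expR u = expR v by rewrite lnK.
have -> : logistic u = expR (u - v) by rewrite /logistic vE expRD expRN.
rewrite /beta_weight /beta_kernel expr1 vE.
have -> : 1 - expR (u - v) = expR (- v).
  by rewrite expRD expRN -vE; field; exact: lt0r_neq0.
by rewrite -!expRM -!expRN -!expRD; congr expR; ring.
Qed.

(** The moments of the weight are the values [B(l + i, 1 - l + j)]. *)
Lemma integral_beta_weight (l : R) (i j : nat) :
  (\int[mu]_(t in `]0%R, 1%R[) (beta_weight l t * (t ^+ i * (1 - t) ^+ j))%:E =
   beta_line (l + i%:R) (1 + (i + j)))%E.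
Proof.
rewrite integral_logistic.
- apply: eq_integral => u _; congr EFin.
  rewrite mulrAC beta_weight_logistic onem_logistic /logistic /beta_kernel expr1.
  rewrite mulrDl expRD expRM_natl expr_div_n exprVn !exprD expr1; field.
  have e1 := lt0r_neq0 (addr1_expR_gt0 u).
  by rewrite e1 !expf_neq0.
- by move=> t; exact: beta_weight_monomial_ge0.
- by move=> t /[!in_itv]/=; exact: beta_weight_monomial_continuous.
Qed.

Lemma beta_line_mean (l : R) : 0 < l < 1 ->
  beta_line (l + 1) 2 = (l * (pi / sin (pi * l)))%:E.
Proof.
move=> l01; have := @beta_lineS R l 1; rewrite mul1e => ->; last by lra.
by rewrite beta_line1E// EFinM.
Qed.

(** [beta_lineS] raises both indices. Raising [n] alone from [beta_line (l + 1) 2] means reflecting,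
    applying the recurrence at [1 - l], and reflecting back. *)
Lemma beta_line_variance (l : R) : 0 < l < 1 ->
  beta_line (l + 1) 3 = (l * (1 - l) / 2 * (pi / sin (pi * l)))%:E.
Proof.
move=> l01; rewrite -beta_line_opp.
have -> : 3%:R - (l + 1) = (1 - l) + 1 by ring.
have := @beta_lineS R (1 - l) 2; rewrite -(beta_line_opp (1 - l) 2).
have -> : 2%:R - (1 - l) = l + 1 by ring.
rewrite beta_line_mean// => /(_ _)/(congr1 (fun z => (2^-1)%:E * z)%E).
rewrite !muleA -EFinM mulVf// mul1e => ->; last by lra.
by rewrite -!EFinM; congr EFin; ring.
Qed.

(** The basis [1, t, t (1 - t)] consists of the monomials [t^i (1 - t)^j] with exponents [(0, 0)],
    [(1, 0)], [(1, 1)]. *)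
Lemma integral_beta_weight_poly (l a b c : R) : 0 < l < 1 ->
  (\int[mu]_(t in `]0%R, 1%R[)
     (beta_weight l t * (a + b * t + c * (t * (1 - t))))%:E =
   ((a + b * l + c * (l * (1 - l) / 2)) * (pi / sin (pi * l)))%:E)%E.
Proof.
move=> l01.
pose w i j t := beta_weight l t * (t ^+ i * (1 - t) ^+ j).
have w00 : (\int[mu]_(t in `]0%R, 1%R[) (w 0 0 t)%:E = (pi / sin (pi * l))%:E)%E.
  by rewrite integral_beta_weight addr0 beta_line1E.
have w10 : (\int[mu]_(t in `]0%R, 1%R[) (w 1 0 t)%:E =
    (l * (pi / sin (pi * l)))%:E)%E.
  by rewrite integral_beta_weight beta_line_mean.
have w11 : (\int[mu]_(t in `]0%R, 1%R[) (w 1 1 t)%:E =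
    (l * (1 - l) / 2 * (pi / sin (pi * l)))%:E)%E.
  by rewrite integral_beta_weight beta_line_variance.
(* A non-negative continuous function with finite integral is integrable. *)
have iw i j : (\int[mu]_(t in `]0%R, 1%R[) (w i j t)%:E < +oo)%E ->
    mu.-integrable `]0%R, 1%R[ (EFin \o w i j).
  move=> h; apply/integrableP; split.
    apply/measurable_EFinP; apply: open_continuous_measurable_fun => // t.
    by rewrite inE/= in_itv/=; exact: beta_weight_monomial_continuous.
  apply: le_lt_trans h; apply: le_integral_nonmeasurable => t /=.
  by rewrite in_itv/= => t01; rewrite lee_fin ger0_norm// beta_weight_monomial_ge0.
have i00 : mu.-integrable `]0%R, 1%R[ (EFin \o w 0 0) by rewrite iw// w00 ltry.
have i10 : mu.-integrable `]0%R, 1%R[ (EFin \o w 1 0) by rewrite iw// w10 ltry.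
have i11 : mu.-integrable `]0%R, 1%R[ (EFin \o w 1 1) by rewrite iw// w11 ltry.
transitivity (\int[mu]_(t in `]0%R, 1%R[)
    (a%:E * (w 0 0 t)%:E + b%:E * (w 1 0 t)%:E + c%:E * (w 1 1 t)%:E))%E.
  by apply: eq_integral => t _; rewrite -!EFinM -!EFinD; congr EFin; rewrite /w; ring.
rewrite integralD//=; [|by apply: integrableD => //; exact: integrableZl|exact: integrableZl].
rewrite integralD//=; [|exact: integrableZl|exact: integrableZl].
rewrite !integralZl// w00 w10 w11 -!EFinM -!EFinD; congr EFin; ring.
Qed.

Lemma integral01_poly (a b c : R) :
  (\int[mu]_(t in `[0%R, 1%R]) (a + b * t + c * (t * (1 - t)))%:E =
   (a + b / 2 + c / 6)%:E)%E.
Proof.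
pose F (t : R) : R := a * t + b / 2 * t ^+ 2 + c / 2 * t ^+ 2 - c / 3 * t ^+ 3.
have dF (t : R) : is_derive t (1:R) F (a + b * t + c * (t * (1 - t))).
  rewrite /F; apply: is_derive_eq; rewrite /GRing.scale/=; by field.
have cF : continuous F.
  by move=> z; apply: differentiable_continuous; apply/derivable1_diffP; case: (dF z).
rewrite (@continuous_FTC2 _ (fun t => a + b * t + c * (t * (1 - t))) F)//.
- by rewrite -EFinB; congr EFin; rewrite /F; field.
- apply: continuous_subspaceT => t.
  apply: cvgD; first by apply: cvgD; [exact: cvg_cst|apply: cvgMl_tmp; exact: cvg_id].
  apply: cvgMl_tmp; apply: cvgM; first exact: cvg_id.
  by apply: cvgB; [exact: cvg_cst|exact: cvg_id].
- split => [t _||]; first by case: (dF t).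
  + by apply: cvg_at_right_filter; exact: cF.
  + by apply: cvg_at_left_filter; exact: cF.
- by move=> t _; rewrite derive1E; case: (dF t).
Qed.

End beta_weight.

(** * Harmonic, geometric and logarithmic means of functionals *)

Lemma bracketB (R : realType) (K : numFieldType) (s : real_or_complex R K)
    (E : tvsType K) (xs : topdual E) (x z : E) :
  bracket s xs (z - x) = bracket s xs z - bracket s xs x.
Proof.
rewrite /bracket linearB/=.
by case: s E xs x z => [|] E xs x z //=; case: (xs z) (xs x) => [? ?] [? ?].
Qed.

Section means.
Context {R : realType} {K : numFieldType} (s : real_or_complex R K) {E : tvsType K}.
Implicit Types (f g : E -> \bar R) (x : E) (xs : topdual E).

Lemma wmeanC t (u v : \bar R) : wmean t u v = wmean (1 - t) v u.
Proof. by rewrite /wmean subKr; exact: (@addrC (\bar^d R)). Qed.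

Lemma wmeanye t (v : \bar R) : t < 1 -> wmean t +oo v = +oo%E.
Proof. by move=> t1; rewrite /wmean gt0_muley ?lte_fin ?subr_gt0. Qed.

Lemma wmeaney t (u : \bar R) : 0 < t -> wmean t u +oo = +oo%E.
Proof. by move=> t0; rewrite wmeanC wmeanye// ltrBlDr ltrDl. Qed.

Lemma harmonic_meanC t f g : Defs.harmonic_mean s t f g = Defs.harmonic_mean s (1 - t) g f.
Proof.
apply/funext => x; rewrite /Defs.harmonic_mean; congr (predual_conjugate s _ x).
by apply/funext => xs; rewrite wmeanC.
Qed.

Lemma conjugate_ge f x xs a : f x = a%:E ->
  ((bracket s xs x - a)%:E <= conjugate s f xs)%E.
Proof. by move=> fx; apply: ereal_sup_ubound; exists x => //; rewrite fx. Qed.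

(** Equality case of Fenchel-Young: the subgradient inequality says that [x] attains the supremum
    defining the conjugate. *)
Lemma conjugate_subdiff f x xs a : f x = a%:E -> subdiff s f x xs ->
  conjugate s f xs = (bracket s xs x - a)%:E.
Proof.
move=> fx [_ sub]; apply/eqP; rewrite eq_le conjugate_ge// andbT.
apply: ge_ereal_sup => _ [z _ <-]; have := sub z; rewrite fx bracketB.
rewrite -[(_ + _)%dE]/((a + (bracket s xs z - bracket s xs x))%:E).
case: (f z) => [c| |] //; last by rewrite leNye.
by rewrite -[(_ - _)%dE]/((bracket s xs z - c)%:E) !lee_fin; lra.
Qed.

Lemma harmonic_mean_le t f g x a b : 0 < t < 1 -> f x = a%:E -> g x = b%:E ->
  (Defs.harmonic_mean s t f g x <= ((1 - t) * a + t * b)%:E)%E.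
Proof.
move=> /andP[t0 t1] fx gx; apply: ge_ereal_sup => _ [xs _ <-].
have := conjugate_ge xs fx; have := conjugate_ge xs gx.
(* Fenchel-Young excludes the value [-oo]; a value [+oo] is absorbing in [wmean] and makes the
   tested term [-oo]. *)
case: (conjugate s f xs) => [u| |]; case: (conjugate s g xs) => [v| |] //;
  rewrite ?wmeanye ?wmeaney//; try by move=> _ _; exact: leNye.
rewrite !lee_fin => hv hu.
nra.
Qed.

Lemma harmonic_mean_ge_subdiff t f g x xs a c : f x = a%:E -> subdiff s f x xs ->
  conjugate s g xs = c%:E ->
  (((1 - t) * a + t * (bracket s xs x - c))%:E <= Defs.harmonic_mean s t f g x)%E.
Proof.
move=> fx sub gc; apply: le_ereal_sup_tmp; exists
  ((bracket s xs x)%:E - wmean t (conjugate s f xs) (conjugate s g xs))%dE.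
  by exists xs.
rewrite (conjugate_subdiff fx sub) gc.
rewrite -[wmean _ _ _]/(((1 - t) * (bracket s xs x - a) + t * c)%:E).
rewrite -[leRHS]/((bracket s xs x - ((1 - t) * (bracket s xs x - a) + t * c))%:E).
by rewrite lee_fin; lra.
Qed.

Lemma conjugate_neqNy f x xs a : f x = a%:E -> conjugate s f xs != -oo%E.
Proof.
by move=> fx; have := conjugate_ge xs fx; case: (conjugate s f xs).
Qed.

(** The supremum [p] need not be attained, so the bound from each subgradient is solved for its
    [diamond] term before passing to the supremum. A harmonic mean equal to [-oo] would force the
    diamond to be [-oo]. *)
Lemma harmonic_mean_ge_diamond t f g x a b p : 0 < t < 1 ->
  f x = a%:E -> g x = b%:E -> diamond s f g x = p%:E ->
  (((1 - t) * a + t * p)%:E <= Defs.harmonic_mean s t f g x)%E.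
Proof.
move=> t01 fx gx dp; have /andP[t0 t1] := t01.
have ge_elt xs c : subdiff s f x xs -> conjugate s g xs = c%:E ->
    (((1 - t) * a + t * (bracket s xs x - c))%:E <= Defs.harmonic_mean s t f g x)%E.
  by move=> sub gc; exact: harmonic_mean_ge_subdiff.
case Hh : (Defs.harmonic_mean s t f g x) ge_elt => [h| |] ge_elt.
- have : (diamond s f g x <= ((h - (1 - t) * a) / t)%:E)%E.
    apply: ge_ereal_sup => _ [xs sub <-].
    have := conjugate_neqNy xs gx.
    case gc : (conjugate s g xs) => [c| |] // _; last by rewrite leNye.
    have := ge_elt _ _ sub gc; rewrite lee_fin => he.
    rewrite -[(_ - _)%dE]/((bracket s xs x - c)%:E) lee_fin.
    by rewrite ler_pdivlMr//; lra.
  by rewrite dp !lee_fin ler_pdivlMr//; lra.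
- by rewrite leey.
- suff : (diamond s f g x <= -oo)%E by rewrite dp.
  apply: ge_ereal_sup => _ [xs sub <-].
  have := conjugate_neqNy xs gx.
  case gc : (conjugate s g xs) => [c| |] // _.
  by have := ge_elt _ _ sub gc.
Qed.

(** The factor [sin (pi * l) / pi] inverts the mass of the weight, so [t] and [t (1 - t)] are
    replaced by their means [l] and [l (1 - l) / 2]. *)
Lemma geometric_mean_le f g x (a b c l : R) : 0 < l < 1 ->
  (forall t, 0 < t < 1 ->
    (Defs.harmonic_mean s t f g x <= (a + b * t + c * (t * (1 - t)))%:E)%E) ->
  (geometric_mean s l f g x <= (a + b * l + c * (l * (1 - l) / 2))%:E)%E.
Proof.
move=> l01 hH; have /andP[l0 l1] := l01; have p0 := @pi_gt0 R.
have s0 : 0 < sin (pi * l) by apply: sin_gt0_pi; nra.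
rewrite /geometric_mean gt_eqF// lt_eqF//.
apply: (@le_trans _ _ ((sin (pi * l) / pi)%:E * \int[lebesgue_measure]_(t in `]0%R, 1%R[)
     (beta_weight l t * (a + b * t + c * (t * (1 - t))))%:E)%E).
  apply: lee_wpmul2l; first by rewrite lee_fin divr_ge0// ltW.
  apply: le_integral_nonmeasurable => t /=; rewrite in_itv/= => t01.
  rewrite [leRHS]EFinM; apply: lee_wpmul2l; last exact: hH.
  by rewrite lee_fin ltW// beta_weight_gt0.
rewrite integral_beta_weight_poly// -EFinM lee_fin le_eqVlt; apply/orP; left.
apply/eqP; move: (sin _) s0 => S S0; move: (pi : R) p0 => P P0.
by field; rewrite !lt0r_neq0.
Qed.

Lemma geometric_mean_ge f g x (a b c l : R) : 0 < l < 1 ->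
  (forall t, 0 < t < 1 ->
    ((a + b * t + c * (t * (1 - t)))%:E <= Defs.harmonic_mean s t f g x)%E) ->
  ((a + b * l + c * (l * (1 - l) / 2))%:E <= geometric_mean s l f g x)%E.
Proof.
move=> l01 hH; have /andP[l0 l1] := l01; have p0 := @pi_gt0 R.
have s0 : 0 < sin (pi * l) by apply: sin_gt0_pi; nra.
rewrite /geometric_mean gt_eqF// lt_eqF//.
apply: (@le_trans _ _ ((sin (pi * l) / pi)%:E * \int[lebesgue_measure]_(t in `]0%R, 1%R[)
     (beta_weight l t * (a + b * t + c * (t * (1 - t))))%:E)%E).
  rewrite integral_beta_weight_poly// -EFinM lee_fin le_eqVlt; apply/orP; left.
  apply/eqP; move: (sin _) s0 => S S0; move: (pi : R) p0 => P P0.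
by field; rewrite !lt0r_neq0.
apply: lee_wpmul2l; first by rewrite lee_fin divr_ge0// ltW.
apply: le_integral_nonmeasurable => t /=; rewrite in_itv/= => t01.
rewrite [leLHS]EFinM; apply: lee_wpmul2l; last exact: hH.
by rewrite lee_fin ltW// beta_weight_gt0.
Qed.

Lemma log_mean_le f g x (a b : R) : f x = a%:E -> g x = b%:E ->
  (log_mean s f g x <= ((a + b) / 2)%:E)%E.
Proof.
move=> fx gx.
have -> : (a + b) / 2 = a + (b - a) / 2 + 0 / 6 :> R by field.
rewrite -integral01_poly; apply: le_integral_nonmeasurable => l /=.
(* The endpoints fall under the conventions for [l = 0] and [l = 1], where no integral is
   involved. *)
rewrite in_itv/= => /andP[]; rewrite le_eqVlt => /predU1P[<- _|l0].
  by rewrite /geometric_mean eqxx fx lee_fin; lra.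
rewrite le_eqVlt => /predU1P[->|l1].
  by rewrite /geometric_mean oner_eq0 eqxx gx lee_fin; lra.
have -> : 0 * (l * (1 - l)) = 0 * (l * (1 - l) / 2) :> R by ring.
apply: geometric_mean_le; first by rewrite l0.
move=> t t01; apply: (le_trans (harmonic_mean_le t01 fx gx)).
by rewrite lee_fin; lra.
Qed.

(* The two affine minorants of [t |-> f !_t g x], weighted by [1 - t] and [t] *)
Lemma log_mean_ge f g x (a b p q : R) : f x = a%:E -> g x = b%:E ->
  (forall t, 0 < t < 1 ->
    (((1 - t) * a + t * p)%:E <= Defs.harmonic_mean s t f g x)%E) ->
  (forall t, 0 < t < 1 ->
    ((t * b + (1 - t) * q)%:E <= Defs.harmonic_mean s t f g x)%E) ->
  (((a + b) / 2 - (a + b - p - q) / 12)%:E <= log_mean s f g x)%E.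
Proof.
move=> fx gx hp hq; set S := a + b - p - q.
have -> : (a + b) / 2 - S / 12 = a + (b - a) / 2 + (- S / 2) / 6 :> R by field.
rewrite -integral01_poly; apply: le_integral_nonmeasurable => l /=.
rewrite in_itv/= => /andP[]; rewrite le_eqVlt => /predU1P[<- _|l0].
  by rewrite /geometric_mean eqxx fx lee_fin; lra.
rewrite le_eqVlt => /predU1P[->|l1].
  by rewrite /geometric_mean oner_eq0 eqxx gx lee_fin; lra.
(* The coefficient [- S] in [t] becomes [- S / 2] in [l]; integrating [l (1 - l)] then gives 1/6,
   hence the total 1/12. *)
have -> : - S / 2 * (l * (1 - l)) = - S * (l * (1 - l) / 2) :> R by field.
apply: geometric_mean_ge; first by rewrite l0.
move=> t t01; have /andP[t0 t1] := t01.
have := hp _ t01; have := hq _ t01.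
case: (Defs.harmonic_mean s t f g x) => [h| |] //; rewrite ?leey// !lee_fin => h1 h2.
have : (1 - t) * ((1 - t) * a + t * p) + t * (t * b + (1 - t) * q) <= h by nra.
by rewrite /S; lra.
Qed.

(** The second minorant is stated with [f] and [g] exchanged, so that the same lower bound on
    harmonic means supplies both hypotheses. Two real bounds force the logarithmic mean to be
    finite. *)
Lemma log_mean_bounds f g x (a b p q : R) : f x = a%:E -> g x = b%:E ->
  (forall t, 0 < t < 1 ->
    (((1 - t) * a + t * p)%:E <= Defs.harmonic_mean s t f g x)%E) ->
  (forall t, 0 < t < 1 ->
    (((1 - t) * b + t * q)%:E <= Defs.harmonic_mean s t g f x)%E) ->
  exists2 m, log_mean s f g x = m%:E &
    0 <= (a + b) / 2 - m <= (a + b - p - q) / 12.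
Proof.
move=> fx gx hp hq.
have hq' t : 0 < t < 1 ->
    ((t * b + (1 - t) * q)%:E <= Defs.harmonic_mean s t f g x)%E.
  move=> t01; rewrite harmonic_meanC; have := hq (1 - t).
  by rewrite subKr; apply; lra.
have := log_mean_ge fx gx hp hq'; have := log_mean_le fx gx.
case: (log_mean s f g x) => [m| |] //; rewrite !lee_fin => h1 h2.
by exists m => //; lra.
Qed.

Lemma subdiff_fin_num f x xs : Defs.proper f -> subdiff s f x xs ->
  exists a, f x = a%:E.
Proof.
by move=> [/(_ x) fNy _] [+ _]; case: (f x) fNy => [a| |] // _ _; exists a.
Qed.

Lemma amean_ge_log_mean f g x (a b : R) : f x = a%:E -> g x = b%:E ->
  (0 <= amean (f x) (g x) - log_mean s f g x)%dE.
Proof.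
move=> fx gx; have := log_mean_le fx gx; rewrite fx gx.
rewrite -[amean _ _]/((2^-1 * (a + b))%:E).
case: (log_mean s f g x) => [m| |] //; last by rewrite leey.
rewrite -[(_ - _)%dE]/((2^-1 * (a + b) - m)%:E) !lee_fin; lra.
Qed.

(** Fenchel-Young for [g]; it excludes the value [+oo] for the diamond. *)
Lemma diamond_le f g x (b : R) : g x = b%:E -> (diamond s f g x <= b%:E)%E.
Proof.
move=> gx; apply: ge_ereal_sup => _ [xs _ <-].
have := conjugate_ge xs gx; case: (conjugate s g xs) => [c| |] //.
  by rewrite -[(_ - _)%dE]/((bracket s xs x - c)%:E) !lee_fin; lra.
by rewrite leNye.
Qed.

End means.

Lemma muley_invn (R : realType) (n : nat) : ((n.+1%:R^-1 : R)%:E * +oo = +oo :> \bar R)%E.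
Proof. by rewrite gt0_muley// lte_fin invr_gt0. Qed.

Lemma muleNy_invn (R : realType) (n : nat) : ((n.+1%:R^-1 : R)%:E * -oo = -oo :> \bar R)%E.
Proof. by rewrite gt0_muleNy// lte_fin invr_gt0. Qed.

Lemma ameanye (R : realType) (v : \bar R) : amean +oo v = +oo%E.
Proof. by rewrite /amean (_ : (+oo + v)%dE = +oo%E) ?muley_invn//; case: v. Qed.

Lemma ameaney (R : realType) (u : \bar R) : amean u +oo = +oo%E.
Proof. by rewrite /amean (_ : (u + +oo)%dE = +oo%E) ?muley_invn//; case: u. Qed.

(** * The upper bounds by Fenchel gaps and by the diamond *)

Section bounds.
Context {R : realType} {K : numFieldType} (s : real_or_complex R K) {E : tvsType K}.
Implicit Types (f g : E -> \bar R) (x : E) (xs zs : topdual E).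

Lemma amean_log_mean_le_gap f g x xs zs (a b : R) : f x = a%:E -> g x = b%:E ->
  subdiff s f x xs -> subdiff s g x zs ->
  (amean (f x) (g x) - log_mean s f g x
     <= (6^-1)%:E * amean (fenchel_gap s g x xs) (fenchel_gap s f x zs))%dE.
Proof.
move=> fx gx fxs gzs; rewrite /fenchel_gap fx gx.
have cNy := conjugate_neqNy s xs gx; have dNy := conjugate_neqNy s zs fx.
(* An infinite conjugate makes its gap, hence the right side, [+oo]. Otherwise [a + b - p - q] is
   the sum of the two gaps. *)
case gc : (conjugate s g xs) cNy => [c| |] // _;
  case fd : (conjugate s f zs) dNy => [d| |] // _;
  try by rewrite /amean !muley_invn leey.
have [t t01|t t01|m -> h] :=
  @log_mean_bounds _ _ s _ f g x a b (bracket s xs x - c) (bracket s zs x - d) fx gx.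
- exact: harmonic_mean_ge_subdiff.
- exact: harmonic_mean_ge_subdiff.
rewrite lee_fin; lra.
Qed.

Lemma amean_log_mean_le_diamond f g x (a b : R) : f x = a%:E -> g x = b%:E ->
  (amean (f x) (g x) - log_mean s f g x
     <= (6^-1)%:E * (amean (f x) (g x)
                   - amean (diamond s f g x) (diamond s g f x)))%dE.
Proof.
move=> fx gx; rewrite fx gx.
have := diamond_le s f gx; have := diamond_le s g fx.
case fg : (diamond s f g x) => [p| |] //; case gf : (diamond s g f x) => [q| |] // _ _;
  (* A diamond equal to [-oo], as when the subdifferential is empty, makes the right side [+oo]. *)
  try by rewrite /amean muleNy_invn [leRHS]muley_invn leey.
have [t t01|t t01|m -> h] := @log_mean_bounds _ _ s _ f g x a b p q fx gx.
- exact: harmonic_mean_ge_diamond t01 fx gx fg.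
- exact: harmonic_mean_ge_diamond t01 gx fx gf.
rewrite lee_fin; lra.
Qed.

End bounds.

Theorem theorem7p7 (R : realType) (K : numFieldType) (s : real_or_complex R K)
    (E : tvsType K) (f g : E -> \bar R)
    (hf : Gamma0 s f) (hg : Gamma0 s g) :
  (forall x : E, subdiff s f x !=set0 -> subdiff s g x !=set0 ->
     forall xs zs : topdual E, subdiff s f x xs -> subdiff s g x zs ->
       (0 <= amean (f x) (g x) - log_mean s f g x)%dE /\
       (amean (f x) (g x) - log_mean s f g x
          <= (6^-1)%:E * amean (fenchel_gap s g x xs) (fenchel_gap s f x zs))%dE)
  /\
  (forall y : E,
     (0 <= amean (f y) (g y) - log_mean s f g y)%dE /\
     (amean (f y) (g y) - log_mean s f g y
        <= (6^-1)%:E * (amean (f y) (g y)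
                      - amean (diamond s f g y) (diamond s g f y)))%dE).
Proof.
case: hf => _ _ pf; case: hg => _ _ pg; split.
  move=> x _ _ xs zs fxs gzs.
  have [a fx] := subdiff_fin_num pf fxs; have [b gx] := subdiff_fin_num pg gzs.
  by split; [exact: amean_ge_log_mean fx gx|exact: amean_log_mean_le_gap fx gx fxs gzs].
move=> y; have := pf.1 y; have := pg.1 y.
case fy : (f y) => [a| |] //; case gy : (g y) => [b| |] // _ _.
- rewrite -fy -gy; split; first exact: amean_ge_log_mean fy gy.
  exact: amean_log_mean_le_diamond fy gy.
(* Here [f y] or [g y] is [+oo], properness having excluded [-oo]; [+oo] is absorbing, so both
   differences are [+oo]. *)
all: have yB (z : \bar R) : (+oo - z = +oo)%dE by case: z.
all: rewrite ?ameanye ?ameaney !yB muley_invn.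
all: by rewrite !leey.
Qed.
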